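(* Let $\mathcal{E}$ and $\mathcal{R}$ be finite sets (entities and relations) and let $m\ge 1$. HolE embeddings can be equivalently obtained using the score function $$\phi(s,r,o)=\Re\big(\langle v_s,v_r,\overline{v_o}\rangle\big),\qquad v_s,v_r,v_o\in\mathfrak{F}(\mathbb{R}^m)\ \ \forall s,r,o,$$ where $\mathfrak{F}(\mathbb{R}^m)\subset\mathbb{C}^m$ is the image of $\mathbb{R}^m$ under the discrete Fourier transform. That is, a function $\phi:\mathcal{E}\times\mathcal{R}\times\mathcal{E}\to\mathbb{R}$ is of the form $\phi(s,r,o)=\langle w_r, w_s\ast w_o\rangle$ for some vectors $w_e\in\mathbb{R}^m$ ($e\in\mathcal{E}$) and $w_r\in\mathbb{R}^m$ ($r\in\mathcal{R}$) if and only if it is of the form $\phi(s,r,o)=\Re(\langle v_s,v_r,\overline{v_o}\rangle)$ for some vectors $v_e\in\mathfrak{F}(\mathbb{R}^m)$ ($e\in\mathcal{E}$) and $v_r\in\mathfrak{F}(\mathbb{R}^m)$ ($r\in\mathcal{R}$). In particular, the latter model becomes the ComplEx model when $\mathfrak{F}(\mathbb{R}^m)$ is relaxed to $\mathbb{C}^m$.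
   Context: The HolE model assigns vectors in $\mathbb{R}^m$ to entities and relations, with score $\phi(s,r,o)=\langle w_r,w_s\ast w_o\rangle$, where $\langle\cdot,\cdot\rangle$ is the standard inner product on $\mathbb{R}^m$ and $\ast$ is circular correlation. With indices taken modulo $m$ starting from $0$, $(a\ast b)_k=\sum_{j}a_{j+k}\,b_j$; equivalently $\langle w_r,w_s\ast w_o\rangle=w_s^\top C(w_r)w_o$, where $C(x)$ is the $m\times m$ circulant matrix with first column $x$, i.e. $C(x)_{ij}=x_{i-j \bmod m}$. The ComplEx model assigns vectors in $\mathbb{C}^m$ to entities and relations, with score $\phi(s,r,o)=\Re(\langle v_s,v_r,\overline{v_o}\rangle)$, where $\langle a,b,c\rangle=\sum_k a_kb_kc_k$ (no conjugation) and $\overline{x}$ is the entrywise complex conjugate. The discrete Fourier transform is $\mathfrak{F}(x)=Fx$ with $F\in\mathbb{C}^{m\times m}$, $F_{jk}=e^{-2\pi i jk/m}$, $0\le j,k\le m-1$. *)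

(* Defs.v *)
From mathcomp Require Import all_boot all_order all_algebra.
From mathcomp Require Import all_classical all_reals all_analysis.
From mathcomp Require Import complex.

Set Implicit Arguments.
Unset Strict Implicit.
Unset Printing Implicit Defensive.

Import Order.TTheory GRing.Theory Num.Theory.

Local Open Scope classical_set_scope.
Local Open Scope ring_scope.
Local Open Scope complex_scope.

(* Vectors have dimension m = n.+1 >= 1, so that the index type 'I_n.+1
   carries addition modulo n.+1 as its ring_scope addition. *)

Definition inner_prod (R : realType) n (a b : 'cV[R]_n.+1) : R :=
  \sum_k a k 0 * b k 0.

(* The sum j + k of indices is taken in the group 'I_n.+1, i.e. modulo n.+1. *)
Definition circ_corr (R : realType) n (a b : 'cV[R]_n.+1) : 'cV[R]_n.+1 :=
  \col_k \sum_j a (j + k) 0 * b j 0.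

Definition HolE_score (R : realType) n (ws wr wo : 'cV[R]_n.+1) : R :=
  inner_prod wr (circ_corr ws wo).

Definition HolE_model (R : realType) n (E Rel : Type)
    : set (E -> Rel -> E -> R) :=
  [set phi | exists (we : E -> 'cV[R]_n.+1) (wr : Rel -> 'cV[R]_n.+1),
     forall s r o, phi s r o = HolE_score (we s) (wr r) (we o)].
Arguments HolE_model {R} n {E Rel} phi : rename.

(* No conjugation: this is not a Hermitian form. *)
Definition trilinear_prod (R : realType) n (a b c : 'cV[R[i]]_n.+1) : R[i] :=
  \sum_k a k 0 * b k 0 * c k 0.

Definition ComplEx_score (R : realType) n (vs vr vo : 'cV[R[i]]_n.+1) : R :=
  complex.Re (trilinear_prod vs vr (map_mx conjc vo)).

Definition ComplEx_model (R : realType) n (E Rel : Type)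
    : set (E -> Rel -> E -> R) :=
  [set phi | exists (ve : E -> 'cV[R[i]]_n.+1) (vr : Rel -> 'cV[R[i]]_n.+1),
     forall s r o, phi s r o = ComplEx_score (ve s) (vr r) (ve o)].
Arguments ComplEx_model {R} n {E Rel} phi : rename.

(* The same score function with every embedding constrained to lie in V. *)
Definition ComplEx_model_in (R : realType) n (V : set 'cV[R[i]]_n.+1)
    (E Rel : Type) : set (E -> Rel -> E -> R) :=
  [set phi | exists (ve : E -> 'cV[R[i]]_n.+1) (vr : Rel -> 'cV[R[i]]_n.+1),
     [/\ forall e, V (ve e),
         forall r, V (vr r) &
         forall s r o, phi s r o = ComplEx_score (ve s) (vr r) (ve o)]].

(* e^(x + iy) = e^x (cos y + i sin y) *)
Definition cexp (R : realType) (z : R[i]) : R[i] :=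
  let: x +i* y := z in (expR x * cos y) +i* (expR x * sin y).

Definition dft_mx (R : realType) n : 'M[R[i]]_n.+1 :=
  \matrix_(j, k) cexp (- (2 * (pi : R)%:C * 'i%C * j%:R * k%:R) / n.+1%:R).

Definition dft (R : realType) n (x : 'cV[R[i]]_n.+1) : 'cV[R[i]]_n.+1 :=
  dft_mx R n *m x.

Definition real_vectors (R : realType) n : set 'cV[R[i]]_n.+1 :=
  range (fun x : 'cV[R]_n.+1 => map_mx (real_complex R) x).
Arguments real_vectors R n : clear implicits.

Definition dft_real_image (R : realType) n : set 'cV[R[i]]_n.+1 :=
  @dft R n @` real_vectors R n.
Arguments dft_real_image R n : clear implicits.

(* Main.v *)
Require Import Defs.
From mathcomp Require Import all_boot all_order all_algebra.
From mathcomp Require Import all_classical all_reals all_analysis.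
From mathcomp Require Import complex ring.

(** The rows of [F] are characters of Z/N, where N = m, so orthogonality of
    characters gives [<Fs, Fr, conj (Fo)> = N * \sum_(a + b = c) s_a r_b o_c]
    for real [s], [r], [o].  In the HolE score the summation constraint is
    [a = b + c] instead, so the two scores are exchanged by reflecting the
    relation vector, [r_b |-> r_(-b)], and rescaling it by N. *)

Import Order.TTheory GRing.Theory Num.Theory.

Local Open Scope classical_set_scope.
Local Open Scope ring_scope.
Local Open Scope complex_scope.

Lemma cexp0 (R : realType) : cexp (0 : R[i]) = 1.
Proof. by rewrite /cexp /= expR0 cos0 sin0 mulr1 mulr0. Qed.

Lemma cexpD (R : realType) (x y : R[i]) : cexp (x + y) = cexp x * cexp y.
Proof.
case: x y => [a b] [c d]; rewrite /cexp /= expRD cosD sinD.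
by apply/eqP; rewrite eq_complex /=; apply/andP; split; apply/eqP; ring.
Qed.

Lemma cexpMn (R : realType) (x : R[i]) k : cexp (x *+ k) = cexp x ^+ k.
Proof.
elim: k => [|k IHk]; first by rewrite mulr0n cexp0 expr0.
by rewrite mulrS cexpD IHk exprS.
Qed.

Definition dft_root (R : realType) n : R[i] :=
  cexp (- (2 * (pi : R)%:C * 'i%C) / n.+1%:R).

Lemma dft_mxE (R : realType) n (j k : 'I_n.+1) :
  dft_mx R n j k = dft_root R n ^+ (j * k).
Proof.
rewrite mxE /dft_root -cexpMn; congr cexp.
by rewrite -[RHS]mulr_natr natrM; ring.
Qed.

(** The angle is kept in the form [2 * _] so that double-angle formulas apply to it when primitivity
    is proved. *)
Lemma dft_root_exprE (R : realType) n k :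
  let t : R := 2 * (k%:R / n.+1%:R * pi) in
  dft_root R n ^+ k = cos t +i* - sin t.
Proof.
move=> t; rewrite /dft_root -cexpMn.
have -> : (- (2 * (pi : R)%:C * 'i%C) / n.+1%:R) *+ k = 0 +i* (- t) :> R[i].
  have -> : 0 +i* (- t) = - (t%:C * 'i%C) :> R[i].
    by apply/eqP; rewrite eq_complex /=; apply/andP; split; apply/eqP; ring.
  rewrite /t !rmorphM /= fmorphV !rmorph_nat -mulr_natr; ring.
by rewrite /cexp expR0 !mul1r cosN sinN.
Qed.

Lemma dft_root_prim (R : realType) n : n.+1.-primitive_root (dft_root R n).
Proof.
apply/andP; split => //; apply/forallP => i; apply/eqP.
rewrite unity_rootE dft_root_exprE.
case: (eqVneq i.+1 n.+1) => [->|neq].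
  rewrite divff ?pnatr_eq0 // mul1r mulr_natl cos2pi.
  by rewrite mulr2n sinD sinpi mulr0 mul0r addr0 oppr0; apply/eqP.
(* For an exponent strictly between 0 and N the real part already differs from 1: it is
   [cos (2 * t) = 1 - 2 * sin t ^+ 2], and the half angle [t] lies strictly between 0 and [pi],
   where the sine is positive. *)
apply/negbTE; rewrite eq_complex /= negb_and; apply/orP; left.
set t := _ * pi.
have t0 : 0 < t by rewrite mulr_gt0 ?divr_gt0 ?ltr0n // pi_gt0.
have tpi : t < pi.
  rewrite gtr_pMl ?pi_gt0 // ltr_pdivrMr ?ltr0n // mul1r ltr_nat.
  by rewrite ltn_neqAle neq ltn_ord.
have st : 0 < sin t by apply: sin_gt0_pi; rewrite t0 tpi.
rewrite mulr_natl mulr2n cosD -!expr2 cos2sin2.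
rewrite -subr_eq0 (_ : _ - 1 = - (2 * sin t ^+ 2)); last by ring.
by rewrite oppr_eq0 mulf_neq0 ?pnatr_eq0 // expf_neq0 // gt_eqF.
Qed.

Lemma dft_root_neq0 (R : realType) n : dft_root R n != 0.
Proof. by rewrite (prim_root_eq0 (dft_root_prim R n)). Qed.

(** The root lies on the unit circle, since cos^2 + sin^2 = 1. *)
Lemma dft_root_conjc (R : realType) n :
  (dft_root R n)^*%C = (dft_root R n)^-1.
Proof.
apply: (mulfI (dft_root_neq0 R n)); rewrite mulfV ?dft_root_neq0 //.
rewrite -[dft_root R n]expr1 dft_root_exprE.
apply/eqP; rewrite eq_complex /= opprK; apply/andP; split; apply/eqP.
  by rewrite mulNr opprK -!expr2 cos2Dsin2.
by ring.
Qed.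

Lemma sum_unity_root (F : fieldType) n (u : F) :
  u ^+ n = 1 -> u != 1 -> \sum_(k < n) u ^+ k = 0.
Proof.
move=> un u1; apply/eqP; have := subrX1 u n; rewrite un subrr => /esym/eqP.
by rewrite mulf_eq0 subr_eq0 (negbTE u1).
Qed.

(** The k-th summand is [u ^+ k], where [u] is the root raised to a + b - c. Since [u] is an N-th
    root of unity, its powers sum to N if [u = 1], and otherwise form a vanishing geometric sum. *)
Lemma dft_mx_ortho (R : realType) n (a b c : 'I_n.+1) :
  \sum_k dft_mx R n k a * dft_mx R n k b * (dft_mx R n k c)^*%C =
  (n.+1 * (a + b == c))%:R.
Proof.
set w := dft_root R n; have wprim := dft_root_prim R n.
have w0 : w != 0 := dft_root_neq0 R n.
pose u := w ^+ (a + b)%N / w ^+ c.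
rewrite (eq_bigr (fun k : 'I_n.+1 => u ^+ k)) => [|k _]; last first.
  rewrite !dft_mxE rmorphXn /= dft_root_conjc -/w /u.
  by rewrite exprVn exprMn exprVn -!exprM mulnDl exprD !(mulnC k).
have uN : u ^+ n.+1 = 1.
  rewrite exprMn exprVn -!exprM !(mulnC _ n.+1) !exprM.
  by rewrite (prim_expr_order wprim) !expr1n invr1 mulr1.
(* In [u] the sum a + b is taken in the naturals, here in ['I_n.+1]; primitivity of the root makes
   exponents matter only modulo N, which reconciles the two. *)
have u1 : (u == 1) = (a + b == c).
  rewrite -(inj_eq (mulIf (expf_neq0 c w0))) mulfVK ?expf_neq0 // mul1r.
  by rewrite (eq_prim_root_expr wprim) (modn_small (ltn_ord c)).
case: (eqVneq u 1) u1 => [-> <-|neq <-].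
  rewrite (eq_bigr (fun=> 1)) => [|k _]; last by rewrite expr1n.
  by rewrite sumr_const card_ord muln1.
by rewrite muln0 sum_unity_root.
Qed.

(** Multilinearity, with the sum over [k] moved inside so that for the DFT matrix it becomes the
    character sum of [dft_mx_ortho]. *)
Lemma trilinear_prod_mulmx (R : realType) n (A : 'M[R[i]]_n.+1)
    (x y z : 'cV[R[i]]_n.+1) :
  trilinear_prod (A *m x) (A *m y) (map_mx conjc (A *m z)) =
  \sum_a \sum_b \sum_c (\sum_k A k a * A k b * (A k c)^*%C) *
                       (x a 0 * y b 0 * (z c 0)^*%C).
Proof.
rewrite /trilinear_prod.
transitivity (\sum_k \sum_a \sum_b \sum_c
    (A k a * A k b * (A k c)^*%C) * (x a 0 * y b 0 * (z c 0)^*%C)).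
  apply: eq_bigr => k _.
  rewrite !mxE rmorph_sum /= !mulr_suml; apply: eq_bigr => a _.
  rewrite -mulrA mulr_suml mulr_sumr; apply: eq_bigr => b _.
  rewrite mulrA mulr_sumr; apply: eq_bigr => c _.
  by rewrite rmorphM /=; ring.
rewrite exchange_big /=; apply: eq_bigr => a _.
rewrite exchange_big /=; apply: eq_bigr => b _.
rewrite exchange_big /=; apply: eq_bigr => c _.
by rewrite mulr_suml.
Qed.

Definition reflect_col {V : Type} {n} (x : 'cV[V]_n.+1) : 'cV[V]_n.+1 :=
  \col_k x (- k) 0.

(** Negating the outer index of the score cancels the reflection, and shifting the inner index by
    [k] then moves the offset from [s] to [o]. *)
Lemma HolE_score_reflect (R : realType) n (s r o : 'cV[R]_n.+1) :
  HolE_score s (reflect_col r) o =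
  \sum_a \sum_b s a 0 * r b 0 * o (a + b) 0.
Proof.
rewrite /HolE_score /inner_prod exchange_big /=.
rewrite (reindex_inj (@oppr_inj 'I_n.+1)) /=; apply: eq_bigr => k _.
rewrite !mxE opprK mulr_sumr (reindex_inj (addIr k)) /=.
by apply: eq_bigr => a _; rewrite addrK; ring.
Qed.

Lemma HolE_scoreZ (R : realType) n (x : R) (s r o : 'cV[R]_n.+1) :
  HolE_score s (x *: r) o = x * HolE_score s r o.
Proof.
by rewrite /HolE_score /inner_prod mulr_sumr; apply: eq_bigr => k _;
   rewrite mxE mulrA.
Qed.

Lemma ComplEx_score_dft (R : realType) n (s r o : 'cV[R]_n.+1) :
  let F (x : 'cV[R]_n.+1) := dft (map_mx (real_complex R) x) in
  ComplEx_score (F s) (F r) (F o) =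
  HolE_score s (n.+1%:R *: reflect_col r) o.
Proof.
move=> F; rewrite /ComplEx_score /F /dft trilinear_prod_mulmx.
rewrite HolE_scoreZ HolE_score_reflect.
set X := (X in complex.Re X); set Y := (Y in _ = Y).
(* For real [s], [r], [o] the trilinear product is itself real, so taking the real part loses
   nothing. *)
suff -> : X = Y%:C by [].
rewrite /X /Y rmorphM rmorph_nat rmorph_sum mulr_sumr.
apply: eq_bigr => a _; rewrite rmorph_sum mulr_sumr; apply: eq_bigr => b _.
(* By orthogonality only c = a + b survives, with weight N. *)
rewrite (bigD1 (a + b)) //= [X in _ + X]big1 => [|c neq]; last first.
  by rewrite dft_mx_ortho eq_sym (negbTE neq) muln0 mul0r.
by rewrite addr0 dft_mx_ortho eqxx muln1 !mxE conjc_real !rmorphM.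
Qed.

Theorem proposition5p3 (R : realType) (E Rel : finType) (n : nat) :
  (forall phi : E -> Rel -> E -> R,
     HolE_model n phi <->
     ComplEx_model_in (dft_real_image R n) phi) /\
  (forall phi : E -> Rel -> E -> R,
     ComplEx_model_in [set: 'cV[R[i]]_n.+1] phi <->
     ComplEx_model n phi).
Proof.
pose F (x : 'cV[R]_n.+1) := dft (map_mx (real_complex R) x).
have FV x : dft_real_image R n (F x).
  by exists (map_mx (real_complex R) x) => //; exists x.
have FK v : dft_real_image R n v -> exists x, F x = v.
  by case=> _ [x _ <-] <-; exists x.
split=> phi; split.
- case=> we [wr phiE].
  (* This inverts the relation map of [ComplEx_score_dft]: reflection is an involution and N is
     invertible. *)
  exists (F \o we), (fun r => F (n.+1%:R^-1 *: reflect_col (wr r))).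
  split=> [e|r|s r o]; [exact: FV | exact: FV |].
  rewrite phiE ComplEx_score_dft; congr HolE_score.
  apply/colP => k.
  by rewrite !mxE opprK mulrA divff ?mul1r // pnatr_eq0.
- case=> ve [vr [veV vrV phiE]].
  have [we weE] := choice (fun e => FK _ (veV e)).
  have [wr wrE] := choice (fun r => FK _ (vrV r)).
  exists we, (fun r => n.+1%:R *: reflect_col (wr r)) => s r o.
  by rewrite phiE -!weE -wrE ComplEx_score_dft.
- by case=> ve [vr [_ _ phiE]]; exists ve, vr.
- by case=> ve [vr phiE]; exists ve, vr; split.
Qed.
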